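(* Let $F,B,X,\sigma,\rho,x_0$ be as in the context. Suppose that $\operatorname{Sol}(F,B)\ne\emptyset$, that $F$ is Lipschitz continuous with constant $L>0$, that $0<\rho<\frac12$, and that the MAEG method is run with stepsizes $\lambda_k=\sigma/L$ for all $k\ge1$. Then $\{u_k\}$ converges to some $\bar{x}\in\operatorname{Sol}(F,B)$, and for all $k\ge1$, $$\|\mathcal{R}^c_{\mathrm{nat}}(y_k)\|\ \le\ \|d_k\|\ \le\ \frac{2L\|u_k-\bar{x}\|}{(1-2\rho)\sigma k}.$$ Since $\lim_{k\to+\infty}\|u_k-\bar{x}\|=0$, the method has an $o(1/k)$ asymptotic convergence rate: $\|d_k\|=o(1/k)$ and $\|\mathcal{R}^c_{\mathrm{nat}}(y_k)\|=o(1/k)$.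
   Context: Problem: $F:\operatorname{dom}F\subseteq\mathbb{R}^n\to\mathbb{R}^n$ is a monotone, continuous (single-valued) operator and $B:\mathbb{R}^n\rightrightarrows\mathbb{R}^n$ is a set-valued maximal monotone operator with $\operatorname{cl}(\operatorname{dom}B)\subseteq\operatorname{dom}F$. $\operatorname{Sol}(F,B)=\{x: 0\in F(x)+B(x)\}$. $\Pi_C$ is the Euclidean projection onto a nonempty closed convex set $C$, and $J_{T}=(\operatorname{Id}+T)^{-1}$ is the resolvent. The composite natural residual is $\mathcal{R}^c_{\mathrm{nat}}(x)=x-J_B(x-F(x))$, $x\in\operatorname{dom}F$. MAEG method. Input: $x_0\in\operatorname{cl}(\operatorname{dom}B)$, $\sigma\in(0,1)$, $\rho\in[0,\frac12)$, and a nonempty closed convex set $X$ with $\operatorname{cl}(\operatorname{dom}B)\subseteq X\subseteq\operatorname{dom}F$. Initialize $u_0=y_0=x_0$, $d_0=0$, $\Lambda_0=0$. For $k=1,2,\dots$: $$x_k=\Pi_X\bigl(\tau_ku_{k-1}+(1-\tau_k)(y_{k-1}-\lambda_kd_{k-1})\bigr),\qquad y_k=J_{\lambda_kB}\bigl(\tau_ku_{k-1}+(1-\tau_k)y_{k-1}-\lambda_kF(x_k)\bigr),$$ where $\tau_k=\frac{\lambda_k}{(1-2\rho)\Lambda_{k-1}+\lambda_k}$, $\Lambda_k=\sum_{i=1}^k\lambda_i$, and $\lambda_k>0$ is chosen so that $\lambda_k\|F(x_k)-F(y_k)\|\le\sigma\|x_k-y_k\|$ (automatically satisfied for $\lambda_k=\sigma/L$);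 then $$d_k=\tfrac1{\lambda_k}\bigl(\tau_ku_{k-1}+(1-\tau_k)y_{k-1}-y_k\bigr)-F(x_k)+F(y_k),\qquad u_k=u_{k-1}-\rho\lambda_kd_k .$$ *)

(* Defs.v *)
(* MathComp / MathComp-Analysis, over an arbitrary R : realType. *)
From HB Require Import structures.
From mathcomp Require Import all_boot all_order all_algebra.
From mathcomp Require Import all_classical all_reals all_analysis.
Set Implicit Arguments.
Unset Strict Implicit.
Unset Printing Implicit Defensive.
Import Order.TTheory GRing.Theory Num.Theory.
Import numFieldNormedType.Exports.
Local Open Scope classical_set_scope.
Local Open Scope ring_scope.

Definition dotv (R : realType) (n : nat) (u v : 'rV[R]_n) : R :=
  \sum_(i < n) u 0 i * v 0 i.

(* The norm `|u| that the library puts on 'rV[R]_n is the sup norm; every norm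
   below is the Euclidean one. Both induce the same topology, so [closure],
   [closed], continuity and convergence are the library's. *)
Definition enorm (R : realType) (n : nat) (u : 'rV[R]_n) : R :=
  Num.sqrt (dotv u u).

(* A single-valued operator F : dom F -> R^n is a total function together with
   the set D = dom F; its values outside D are never constrained. *)
Definition monotone_on (R : realType) (n : nat)
    (D : set 'rV[R]_n) (F : 'rV[R]_n -> 'rV[R]_n) : Prop :=
  forall x y, D x -> D y -> 0 <= dotv (F x - F y) (x - y).

Definition elipschitz_on (R : realType) (n : nat) (L : R)
    (D : set 'rV[R]_n) (F : 'rV[R]_n -> 'rV[R]_n) : Prop :=
  forall x y, D x -> D y -> enorm (F x - F y) <= L * enorm (x - y).

(* A set-valued operator maps each point to the set of its images. *)
Definition sv_operator (R : realType) (n : nat) : Type :=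
  'rV[R]_n -> set 'rV[R]_n.

Definition sv_dom (R : realType) (n : nat) (B : sv_operator R n)
  : set 'rV[R]_n := [set x | B x !=set0].

Definition sv_monotone (R : realType) (n : nat) (B : sv_operator R n) : Prop :=
  forall x y v w, B x v -> B y w -> 0 <= dotv (v - w) (x - y).

Definition maximal_monotone (R : realType) (n : nat) (B : sv_operator R n)
  : Prop :=
  sv_monotone B /\
  forall B' : sv_operator R n, sv_monotone B' ->
    (forall x, B x `<=` B' x) -> forall x, B' x `<=` B x.

Definition sv_scale (R : realType) (n : nat) (lam : R) (B : sv_operator R n)
  : sv_operator R n := fun x => [set lam *: v | v in B x].

Definition Sol (R : realType) (n : nat) (D : set 'rV[R]_n)
    (F : 'rV[R]_n -> 'rV[R]_n) (B : sv_operator R n) : set 'rV[R]_n :=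
  [set x | D x /\ exists2 v, B x v & F x + v = 0].

(* Total functions by choice: the default value 0 is only taken when no point
   has the required property, which never happens for the projection onto a
   nonempty closed convex set or for the resolvent of a maximal monotone
   operator; in these cases the point is also unique. *)
Definition proj (R : realType) (n : nat) (C : set 'rV[R]_n) (x : 'rV[R]_n)
  : 'rV[R]_n :=
  xget 0 [set p | C p /\ forall q, C q -> enorm (x - p) <= enorm (x - q)].

Definition resolvent (R : realType) (n : nat) (T : sv_operator R n)
    (x : 'rV[R]_n) : 'rV[R]_n :=
  xget 0 [set z | exists2 v, T z v & z + v = x].

Definition natres (R : realType) (n : nat) (F : 'rV[R]_n -> 'rV[R]_n)
    (B : sv_operator R n) (x : 'rV[R]_n) : 'rV[R]_n :=
  x - resolvent B (x - F x).

Definition Lam (R : realType) (lam : nat -> R) (k : nat) : R :=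
  \sum_(1 <= i < k.+1) lam i.

Definition tau (R : realType) (rho : R) (lam : nat -> R) (k : nat) : R :=
  lam k / ((1 - 2 * rho) * Lam lam k.-1 + lam k).

(* [MAEG_run F B X sigma rho x0 lam x y d u]: the sequences are generated by
   the method from x0 with stepsizes lam. The value lam 0 plays no role. *)
Record MAEG_run (R : realType) (n : nat) (F : 'rV[R]_n -> 'rV[R]_n)
    (B : sv_operator R n) (X : set 'rV[R]_n) (sigma rho : R) (x0 : 'rV[R]_n)
    (lam : nat -> R) (x y d u : nat -> 'rV[R]_n) : Prop := {
  MAEG_x0 : x 0%N = x0 ;
  MAEG_u0 : u 0%N = x0 ;
  MAEG_y0 : y 0%N = x0 ;
  MAEG_d0 : d 0%N = 0 ;
  MAEG_lam_gt0 : forall k, (1 <= k)%N -> 0 < lam k ;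
  MAEG_stepsize : forall k, (1 <= k)%N ->
    lam k * enorm (F (x k) - F (y k)) <= sigma * enorm (x k - y k) ;
  MAEG_x : forall k, (1 <= k)%N ->
    x k = proj X (tau rho lam k *: u k.-1
                  + (1 - tau rho lam k) *: (y k.-1 - lam k *: d k.-1)) ;
  MAEG_y : forall k, (1 <= k)%N ->
    y k = resolvent (sv_scale (lam k) B)
            (tau rho lam k *: u k.-1 + (1 - tau rho lam k) *: y k.-1
             - lam k *: F (x k)) ;
  MAEG_d : forall k, (1 <= k)%N ->
    d k = (lam k)^-1 *: (tau rho lam k *: u k.-1
                         + (1 - tau rho lam k) *: y k.-1 - y k)
          - F (x k) + F (y k) ;
  MAEG_u : forall k, (1 <= k)%N -> u k = u k.-1 - (rho * lam k) *: d k
}.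

(* Main.v *)
Require Import Defs.
From HB Require Import structures.
From mathcomp Require Import all_boot all_order all_algebra.
From mathcomp Require Import all_classical all_reals all_analysis.
From mathcomp Require Import ring lra.
Set Implicit Arguments.
Unset Strict Implicit.
Unset Printing Implicit Defensive.
Import Order.TTheory GRing.Theory Num.Theory.
Import numFieldNormedType.Exports.
Local Open Scope classical_set_scope.
Local Open Scope ring_scope.

(** For [k >= 1] the vector [d k] is a residual: [d k - F (y k)] belongs to
[B (y k)], so [d k] is a value of the monotone operator [F + B] at [y k]. The proof rests on
the energy estimate [energy_le0]: with [eta := 1 - 2 * rho] and [la := sigma / L],
   [eta * k * la / 2 * |d k|^2 + <d k, y k - u k> <= 0].
It goes from [k] to [k + 1] by monotonicity of [F + B] at [y k] and [y (k + 1)],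
the stepsize rule, and the fact that projecting onto [X] does not increase the
distance to a point of [X] ([energy_step], [error_le]).

For a solution [z], monotonicity gives [<d k, y k - z> >= 0]; with the energy
estimate this yields [eta * k * la / 2 * |d k|^2 <= <d k, u k - z>]. Two
consequences follow. By Cauchy-Schwarz, [|d k|] is at most a constant times
[|u k - z| / k] ([residual_rate]). And since [u] moves along [- d], the squared
distance from [u k] to [z] decreases by at least a constant times [k * |d k|^2]
at each step ([fejer]); so [u] is bounded, and [k * |d k|^2] is summable because
[rho > 0].

The limit is found as a cluster point of [u]. The gap [y k - u k] is contracted
at each step by a factor at most [1 - 1 / (k + 1)], up to an increment of the
size of [d k] and [d (k + 1)]. Summability of [k * |d k|^2] and divergence of
the harmonic series give a subsequence along which the gap vanishes
([gap_small]). A cluster point [xbar] of [u] along it is a cluster point of [y]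
as well, with residuals tending to 0, hence a solution ([cluster_Sol]). The
distance from [u k] to [xbar] decreases and has 0 as a cluster value, so it
tends to 0; the bound of [residual_rate] for [z := xbar] is then [o(1 / k)].

The method is defined through projections and resolvents, whose existence
(Minty's theorem, for the resolvent) is derived from one fact: the concave
function [t - |z|^2] on a convex subset of [R^n * R] where it is bounded above
has a maximizing sequence that converges, by strong concavity in [z]
([concave_maximum]). *)

(** * Euclidean inner product and norm *)

Section InnerProduct.
Context {R : realType} {n : nat}.
Implicit Types (u v w : 'rV[R]_n) (a : R).

Lemma dotvC u v : dotv u v = dotv v u.
Proof. by apply: eq_bigr => i _; rewrite mulrC. Qed.

Lemma dotvDl u v w : dotv (u + v) w = dotv u w + dotv v w.
Proof. by rewrite /dotv -big_split; apply: eq_bigr => i _; rewrite !mxE mulrDl. Qed.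

Lemma dotvZl a u v : dotv (a *: u) v = a * dotv u v.
Proof. by rewrite /dotv mulr_sumr; apply: eq_bigr => i _; rewrite !mxE mulrA. Qed.

Lemma dotvNl u v : dotv (- u) v = - dotv u v.
Proof. by rewrite -scaleN1r dotvZl mulN1r. Qed.

Lemma dotv0l u : dotv 0 u = 0.
Proof. by rewrite -(scale0r 0) dotvZl mul0r. Qed.

Lemma dotvDr u v w : dotv w (u + v) = dotv w u + dotv w v.
Proof. by rewrite dotvC dotvDl !(dotvC w). Qed.

Lemma dotvZr a u v : dotv u (a *: v) = a * dotv u v.
Proof. by rewrite dotvC dotvZl dotvC. Qed.

Lemma dotvNr u v : dotv u (- v) = - dotv u v.
Proof. by rewrite dotvC dotvNl dotvC. Qed.

Lemma dotv0r u : dotv u 0 = 0.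
Proof. by rewrite dotvC dotv0l. Qed.

Definition dotvE := (dotvDl, dotvDr, dotvNl, dotvNr, dotvZl, dotvZr).

Lemma dotv_ge0 u : 0 <= dotv u u.
Proof. by apply: sumr_ge0 => i _; rewrite -expr2 sqr_ge0. Qed.

Lemma enorm_ge0 u : 0 <= enorm u.
Proof. exact: sqrtr_ge0. Qed.

Lemma enorm_sqr u : enorm u ^+ 2 = dotv u u.
Proof. by rewrite sqr_sqrtr // dotv_ge0. Qed.

Lemma enorm0 : enorm (0 : 'rV[R]_n) = 0.
Proof. by rewrite /enorm dotv0l sqrtr0. Qed.

Lemma enormN u : enorm (- u) = enorm u.
Proof. by rewrite /enorm !dotvE opprK. Qed.

Lemma enormB u v : enorm (u - v) = enorm (v - u).
Proof. by rewrite -enormN opprB. Qed.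

Lemma enormZ a u : enorm (a *: u) = `|a| * enorm u.
Proof. by rewrite /enorm !dotvE mulrA -expr2 sqrtrM ?sqr_ge0// sqrtr_sqr. Qed.

Lemma le_enorm u v : (enorm u <= enorm v) = (dotv u u <= dotv v v).
Proof. by rewrite ler_sqrt // dotv_ge0. Qed.

Lemma dotv_eq0 u : dotv u u <= 0 -> u = 0.
Proof.
move=> u0; apply/rowP => i; rewrite mxE; apply/eqP; rewrite -sqrf_eq0 expr2.
have sq_ge0 j : true -> 0 <= u 0 j * u 0 j by rewrite -expr2 sqr_ge0.
have /psumr_eq0P -/(_ sq_ge0)-> // : dotv u u = 0.
by apply/eqP; rewrite eq_le u0 dotv_ge0.
Qed.

Lemma cauchy_schwarz u v : dotv u v <= enorm u * enorm v.
Proof.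
have [u0|u0] := eqVneq (enorm u) 0.
  have -> : u = 0 by apply: dotv_eq0; rewrite -enorm_sqr u0 expr0n.
  by rewrite dotv0l enorm0 mul0r.
have up : 0 < enorm u by rewrite lt0r u0 enorm_ge0.
have := dotv_ge0 (enorm v *: u - enorm u *: v).
have [v0|v0] := eqVneq (enorm v) 0.
  have -> : v = 0 by apply: dotv_eq0; rewrite -enorm_sqr v0 expr0n.
  by rewrite dotv0r enorm0 mulr0.
have vp : 0 < enorm v by rewrite lt0r v0 enorm_ge0.
rewrite !dotvE (dotvC v u) -(enorm_sqr u) -(enorm_sqr v) => h.
have := mulr_gt0 up vp; set p := enorm u * enorm v => pp.
have : 0 <= p * (p - dotv u v) by rewrite /p; lra.
by rewrite pmulr_rge0 // subr_ge0.
Qed.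

Lemma enormD u v : enorm (u + v) <= enorm u + enorm v.
Proof.
rewrite -(ler_pXn2r (_ : 0 < 2)%N) ?nnegrE ?addr_ge0 ?enorm_ge0 //.
rewrite sqrrD !enorm_sqr !dotvE (dotvC v u).
have := cauchy_schwarz u v; lra.
Qed.

Lemma normv_le_enorm u : `|u| <= enorm u.
Proof.
rewrite [`|u|]mx_normrE; apply: bigmax_le; first exact: enorm_ge0.
move=> [i j] _ /=; rewrite ord1 -sqrtr_sqr ler_sqrt ?sqr_ge0 ?dotv_ge0 //.
by rewrite /dotv (bigD1 j) //= expr2 lerDl sumr_ge0 // => k _; rewrite -expr2 sqr_ge0.
Qed.

End InnerProduct.

Section Topology.
Context {R : realType} {n : nat}.

Lemma cvg_dotv (T : Type) (F : set_system T) {FF : Filter F}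
    (f g : T -> 'rV[R]_n) (a b : 'rV[R]_n) :
  f @ F --> a -> g @ F --> b -> (fun t => dotv (f t) (g t)) @ F --> dotv a b.
Proof.
move=> fa gb; apply: cvg_big; first exact: add_continuous.
move=> i _.
have coord (h : T -> 'rV[R]_n) (c : 'rV[R]_n) :
    h @ F --> c -> (fun t => h t 0 i) @ F --> c 0 i.
  by move=> hc; exact: (cvg_comp h (fun z : 'rV[R]_n => z 0 i) hc
    (@coord_continuous R 1 n 0 i c)).
by apply: cvgM; exact: coord.
Qed.

Lemma cvg_enorm (T : Type) (F : set_system T) {FF : Filter F}
    (f : T -> 'rV[R]_n) (a : 'rV[R]_n) :
  f @ F --> a -> (fun t => enorm (f t)) @ F --> enorm a.
Proof.
move=> fa; exact: (cvg_comp _ _ (cvg_dotv fa fa) (@sqrt_continuous R _)).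
Qed.

Lemma near_enorm (a : 'rV[R]_n) (e : R) : 0 < e ->
  \forall z \near a, enorm (z - a) < e.
Proof.
move=> e0; have h : (fun z => z - a) @ a --> a - a.
  apply: (@cvgB _ _ _ (nbhs a) _ id (cst a)); first exact: cvg_id.
  exact: (@cvg_cst _ a _ (nbhs a)).
have := cvg_enorm (FF := nbhs_filter a) h; rewrite subrr enorm0 => h0.
exact: (cvgr_lt _ h0 _ e0).
Qed.

Lemma enorm_cvg (u : nat -> 'rV[R]_n) (a : 'rV[R]_n) :
  (fun k => enorm (u k - a)) @ \oo --> (0 : R) -> u @ \oo --> a.
Proof.
move=> h; apply/cvgrPdist_lt => e e0.
apply: filterS (cvgr_lt _ h _ e0) => k.
by apply: le_lt_trans; rewrite distrC normv_le_enorm.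
Qed.

Lemma closure_enormP (A : set 'rV[R]_n) (a : 'rV[R]_n) :
  (forall e, 0 < e -> exists2 z, A z & enorm (z - a) < e) -> closure A a.
Proof.
move=> h V /nbhs_ballP[e /= e0 eV]; have [z Az za] := h _ e0.
exists z; split=> //; apply: eV; rewrite -ball_normE /=.
by rewrite distrC (le_lt_trans (normv_le_enorm _)).
Qed.

(** Bolzano-Weierstrass. *)
Lemma bounded_cluster (u : nat -> 'rV[R]_n) (M : R) :
  (forall k, enorm (u k) <= M) -> exists a, forall e, 0 < e ->
  forall N, exists2 k, (N <= k)%N & enorm (u k - a) < e.
Proof.
move=> uM.
have cK : compact [set x : 'rV[R]_n | `|x| <= M].
  apply: bounded_closed_compact.
    by exists M; split => [|r /ltW Mr x /= xM]; [exact: num_real|exact: le_trans Mr].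
  apply: (@closed_comp _ _ (fun x : 'rV[R]_n => `|x|) [set r | r <= M]).
    by move=> x _; exact: norm_continuous.
  exact: closed_le.
have uK : (u @ \oo) [set x : 'rV[R]_n | `|x| <= M].
  by exists 0%N => // k _; exact: le_trans (normv_le_enorm _) (uM k).
have [a [_ ca]] := cK (u @ \oo) _ uK.
exists a => e e0 N.
have [|z [/= [k Nk <-] ?]] := ca [set u k | k in [set k | (N <= k)%N]] _ _
  (near_enorm a e0); first by exists N => // k Nk; exists k.
by exists k.
Unshelve. all: by end_near. Qed.

End Topology.

(** * Maximization of a strongly concave function *)

Section ConcaveMaximum.
Context {R : realType} {n : nat}.

Lemma cvg_le_cst (f : nat -> R) (l c : R) :
  f @ \oo --> l -> (forall m, f m <= c) -> l <= c.
Proof. by move=> fl fc; apply: (cvgr_to_le fl); exact: nearW. Qed.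

Lemma harmonic_small (e : R) : 0 < e -> exists N, forall m, (N <= m)%N -> m.+1%:R^-1 < e.
Proof. by move=> e0; have [N _ h] := cvgr_lt _ (@cvg_harmonic R) _ e0; exists N. Qed.

(** The limit [s --> 0] in a first-order condition. *)
Lemma le0_small (a b : R) :
  (forall s, 0 < s -> s < 1 -> a <= s * b) -> a <= 0.
Proof.
move=> h; rewrite leNgt; apply/negP => a0.
have ab : a <= 2^-1 * b by apply: h; lra.
have b0 : 0 < b by lra.
have s0 : 0 < a / (2 * b) by rewrite divr_gt0 // mulr_gt0.
have s1 : a / (2 * b) < 1 by rewrite ltr_pdivrMr ?mulr_gt0 // mul1r; lra.
have := h _ s0 s1.
have -> : a / (2 * b) * b = a / 2 by field; rewrite gt_eqF.
lra.
Qed.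

(** A maximizing sequence of [t - dotv z z] over the convex set [S] is Cauchy in
    [z], by strong concavity; the last inequality is the first-order optimality
    condition at its limit, which may lie outside [S]. *)
Lemma concave_maximum (S : 'rV[R]_n -> R -> Prop) (M : R) :
  (exists z t, S z t) ->
  (forall z t z' t' (s : R), S z t -> S z' t' -> 0 < s -> s < 1 ->
     S ((1 - s) *: z + s *: z') ((1 - s) * t + s * t')) ->
  (forall z t, S z t -> t - dotv z z <= M) ->
  exists (z : nat -> 'rV[R]_n) (t : nat -> R) (z_ : 'rV[R]_n) (t_ : R),
    [/\ forall m, S (z m) (t m), z @ \oo --> z_, t @ \oo --> t_ &
        forall w r, S w r -> r - t_ <= 2 * dotv z_ (w - z_)].
Proof.
move=> [z0 [t0 S0]] Sconv SM.
pose V := [set a | exists z t, S z t /\ a = t - dotv z z].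
have hs : has_sup V.
  split; first by exists (t0 - dotv z0 z0), z0, t0.
  by exists M => _ [z [t [Szt ->]]]; exact: SM.
have leV z t : S z t -> t - dotv z z <= sup V.
  by move=> Szt; apply: (sup_upper_bound hs); exists z, t.
have /choice[p Pp] : forall m : nat, exists p : 'rV[R]_n * R,
    S p.1 p.2 /\ sup V - m.+1%:R^-1 < p.2 - dotv p.1 p.1.
  move=> m; have m0 : 0 < m.+1%:R^-1 :> R by rewrite invr_gt0 ltr0n.
  by have [_ [z [t [Szt ->]]] ?] := sup_adherent m0 hs; exists (z, t).
pose z m := (p m).1; pose t m := (p m).2.
have Sp m : S (z m) (t m) by have [] := Pp m.
have ps m : sup V - m.+1%:R^-1 < t m - dotv (z m) (z m) by have [] := Pp m.
(* Strong concavity: the midpoint gains a quarter of the squared distance. *)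
have gap k l : dotv (z k - z l) (z k - z l) <= 2 * (k.+1%:R^-1 + l.+1%:R^-1).
  have := leV _ _ (Sconv _ _ _ _ 2^-1 (Sp k) (Sp l) _ _).
  rewrite !dotvE (dotvC (z l) (z k)) => mid.
  have {}mid := mid ltac:(lra) ltac:(lra).
  by have := ps k; have := ps l; move: (k.+1%:R^-1) (l.+1%:R^-1) => a b; lra.
have [z_ zz] : exists z_ : 'rV[R]_n, z @ \oo --> z_.
  suff : cvgn z by move=> /cvg_ex.
  apply/cauchy_cvgP; apply: cauchy_exP => e e0.
  have [|N hN] := @harmonic_small (e ^+ 2 / 4); first by rewrite divr_gt0 ?exprn_gt0.
  exists (z N), N => // m /= Nm; rewrite -ball_normE /=.
  apply: le_lt_trans (normv_le_enorm _) _.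
  rewrite -(ltr_pXn2r (_ : 0 < 2)%N) ?nnegrE ?enorm_ge0 ?(ltW e0) // enorm_sqr.
  by have := hN N (leqnn N); have := hN m Nm; have := gap N m;
    move: (N.+1%:R^-1) (m.+1%:R^-1) => a b; lra.
have tt : t @ \oo --> sup V + dotv z_ z_.
  have -> : t = (fun m => (t m - dotv (z m) (z m)) + dotv (z m) (z m)).
    by apply/funext => m; rewrite subrK.
  apply: cvgD; last exact: cvg_dotv.
  apply: (@squeeze_cvgr _ _ _ _ (fun m => sup V - m.+1%:R^-1) (cst (sup V))).
  - by near=> m; rewrite (ltW (ps m)) /=; exact: leV.
  - rewrite -[X in _ --> X]subr0; apply: cvgB; first exact: cvg_cst.
    exact: cvg_harmonic.
  - exact: cvg_cst.
exists z, t, z_, (sup V + dotv z_ z_); split=> // w r Swr.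
rewrite -subr_le0; apply: (@le0_small _ (dotv (w - z_) (w - z_))) => /= s s0 s1.
(* First-order optimality along the segment from the maximizer to (w, r). *)
have key : (1 - s) * (sup V + dotv z_ z_) + s * r -
    ((1 - s) ^+ 2 * dotv z_ z_ + 2 * s * (1 - s) * dotv z_ w + s ^+ 2 * dotv w w)
    <= sup V.
  pose f m : R := (1 - s) * t m + s * r - ((1 - s) ^+ 2 * dotv (z m) (z m)
    + 2 * s * (1 - s) * dotv (z m) w + s ^+ 2 * dotv w w).
  apply: (@cvg_le_cst f); last first.
    move=> m; have := leV _ _ (Sconv _ _ _ _ s (Sp m) Swr s0 s1).
    by rewrite /f !dotvE (dotvC w (z m)); apply: le_trans; lra.
  have cst_cvg (c : R) : (fun=> c) @ \oo --> c by exact: cvg_cst.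
  have zw : (fun m => dotv (z m) w) @ \oo --> dotv z_ w.
    by apply: cvg_dotv => //; exact: cvg_cst.
  have zz2 : (fun m => dotv (z m) (z m)) @ \oo --> dotv z_ z_ by exact: cvg_dotv.
  exact: (cvgB (cvgD (cvgM (cst_cvg (1 - s)) tt) (cst_cvg (s * r)))
    (cvgD (cvgD (cvgM (cst_cvg ((1 - s) ^+ 2)) zz2)
       (cvgM (cst_cvg (2 * s * (1 - s))) zw)) (cst_cvg (s ^+ 2 * dotv w w)))).
rewrite -(ler_pM2l s0); move: key; rewrite !dotvE (dotvC w z_); lra.
Unshelve. all: by end_near. Qed.

End ConcaveMaximum.
(** * Euclidean projection *)

Section Projection.
Context {R : realType} {n : nat}.
Implicit Types (X : set 'rV[R]_n) (w p q : 'rV[R]_n).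

Lemma convex_set_segment X p q (s : R) : convex_set X ->
  X p -> X q -> 0 < s -> s < 1 -> X ((1 - s) *: p + s *: q).
Proof.
move=> cX Xp Xq s0 s1.
have := cX q p (Itv01 (ltW s0) (ltW s1)) (mem_set Xq) (mem_set Xp).
by rewrite addrC => /set_mem.
Qed.

(** Maximizing [2 * dotv q w - dotv q q] over [X] is minimizing the squared
    distance to [w]. *)
Lemma projection_exists X w : X !=set0 -> closed X -> convex_set X ->
  exists2 p, X p & forall q, X q -> dotv (w - p) (q - p) <= 0.
Proof.
move=> [q0 Xq0] Xcl Xcv.
have [|||z [t [p [t_ [St zp tt h]]]]] := @concave_maximum R n
    (fun q r => X q /\ r = 2 * dotv q w) (dotv w w).
- by exists q0, (2 * dotv q0 w).
- move=> q r q' r' s [Xq ->] [Xq' ->] s0 s1; split; first exact: convex_set_segment.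
  by rewrite !dotvE; ring.
- move=> q r [_ ->]; have := dotv_ge0 (w - q).
  by rewrite !dotvE (dotvC w q); lra.
have Xp : X p.
  by apply: closed_cvg zp => //; apply: nearW => m; have [] := St m.
have t_E : t_ = 2 * dotv p w.
  apply: (cvg_unique _ tt) => //.
  have -> : t = (fun m => 2 * dotv (z m) w).
    by apply/funext => m; have [] := St m.
  by apply: cvgM; [exact: cvg_cst|apply: cvg_dotv => //; exact: cvg_cst].
exists p => // q Xq; have := h q _ (conj Xq erefl).
by rewrite t_E !dotvE (dotvC w q) (dotvC w p); lra.
Qed.

(** The existence lemma provides the point [p] with the variational inequality;
    the minimizer chosen by [proj] must be [p]. *)
Lemma enorm_proj_le X w q : X !=set0 -> closed X -> convex_set X -> X q ->
  enorm (Defs.proj X w - q) <= enorm (w - q).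
Proof.
move=> X0 Xcl Xcv Xq; have [p Xp ph] := @projection_exists X w X0 Xcl Xcv.
have pmin q' : X q' -> dotv (w - p) (w - p) + dotv (q' - p) (q' - p)
    <= dotv (w - q') (w - q').
  move=> /ph; have -> : w - q' = (w - p) - (q' - p) by rewrite opprB addrA subrK.
  by move: (w - p) (q' - p) => a b; rewrite !dotvE (dotvC b a); lra.
have [] : [set p' | X p' /\ forall q', X q' -> enorm (w - p') <= enorm (w - q')]
    (Defs.proj X w).
  apply: xgetPex; exists p; split => // q' /pmin.
  by rewrite le_enorm; have := dotv_ge0 (q' - p); lra.
move: (Defs.proj X w) => p' Xp' /(_ p Xp); rewrite le_enorm => p'p.
have /dotv_eq0/eqP : dotv (p' - p) (p' - p) <= 0 by have := pmin _ Xp'; lra.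
rewrite subr_eq0 => /eqP ->.
by have := pmin _ Xq; have := dotv_ge0 (w - p); rewrite enormB le_enorm; lra.
Qed.

End Projection.

(** * Maximal monotone operators and Minty's theorem *)

Section Minty.
Context {R : realType} {n : nat}.
Implicit Types (B : sv_operator R n).

(** Maximality in pointwise form: otherwise the pair could be added to the
    graph. *)
Lemma maximal_monotone_mem B x v : maximal_monotone B ->
  (forall y w, B y w -> 0 <= dotv (v - w) (x - y)) -> B x v.
Proof.
move=> [monB maxB] h.
pose B' : sv_operator R n := fun y w => B y w \/ (y = x /\ w = v).
apply: (maxB B'); last by right.
  move=> y z w1 w2 [Byw|[-> ->]] [Bzw|[-> ->]].
  - exact: monB.
  - by have := h _ _ Byw; rewrite -opprB -(opprB y x) dotvNl dotvNr opprK.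
  - exact: h.
  - by rewrite !subrr dotv0l.
by move=> y w; left.
Qed.

Lemma sv_scale_monotone B (lam : R) : 0 <= lam -> sv_monotone B ->
  sv_monotone (sv_scale lam B).
Proof.
move=> lam0 monB x y _ _ [v Bv <-] [w Bw <-].
by rewrite -scalerBr dotvZl mulr_ge0 //; exact: monB.
Qed.

Lemma maximal_monotone_scale B (lam : R) : 0 < lam ->
  maximal_monotone B -> maximal_monotone (sv_scale lam B).
Proof.
move=> lam0 maxB; split; first exact: sv_scale_monotone (ltW lam0) maxB.1.
move=> B' monB' BB' x v B'v; exists (lam^-1 *: v); last first.
  by rewrite scalerA divff ?scale1r // gt_eqF.
apply: (maximal_monotone_mem maxB) => y w Byw.
have -> : lam^-1 *: v - w = lam^-1 *: (v - lam *: w).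
  by rewrite scalerBr scalerA mulVf ?scale1r // gt_eqF.
rewrite dotvZl mulr_ge0 ?invr_ge0 ?(ltW lam0) //; apply: monB' => //.
by apply: BB'; exists w.
Qed.

Lemma maximal_monotone_inhabited B : maximal_monotone B -> exists x v, B x v.
Proof.
move=> maxB; case: (pselect (exists x v, B x v)) => // noB.
exists 0, 0; apply: (maximal_monotone_mem maxB) => y w Byw.
by exfalso; apply: noB; exists y, w.
Qed.

(** Minty's theorem for the operator [y |-> B y - x]. A graph point [(y, w)] is
    encoded by the triple [(y, w, - dotv w y)]; on two such triples [graph_form]
    is [- dotv (w - w') (y - y')], so monotonicity of the operator says that this
    form, affine in each argument, is nonpositive on its graph. *)
Let point : Type := ('rV[R]_n * 'rV[R]_n * R)%type.

Definition graph_form (P Q : point) : R :=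
  P.2 + Q.2 + dotv P.1.1 Q.1.2 + dotv P.1.2 Q.1.1.

Definition graph_polar (G : point -> Prop) (P : point) : Prop :=
  forall Q, G Q -> graph_form P Q <= 0.

Lemma graph_formC P Q : graph_form P Q = graph_form Q P.
Proof.
rewrite /graph_form (dotvC P.1.1) (dotvC P.1.2); ring.
Qed.

Lemma sub_bipolar G P : G P -> graph_polar (graph_polar G) P.
Proof. by move=> GP Q /(_ P GP); rewrite graph_formC. Qed.

(** The bipolar replaces the convex hull of the graph: it is convex by
    definition, and it lies in both [graph_polar G] and its polar. *)
Lemma bipolar_diag G P : (forall Q, G Q -> graph_polar G Q) ->
  graph_polar (graph_polar G) P -> graph_form P P <= 0.
Proof. by move=> GG PP; apply: (PP P) => Q GQ; exact/PP/GG. Qed.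

Lemma graph_polar_convex G x v t x' v' t' (s : R) : 0 < s -> s < 1 ->
  graph_polar G (x, v, t) -> graph_polar G (x', v', t') ->
  graph_polar G ((1 - s) *: x + s *: x', (1 - s) *: v + s *: v',
                 (1 - s) * t + s * t').
Proof.
move=> s0 s1 P P' Q GQ.
have -> : graph_form ((1 - s) *: x + s *: x', (1 - s) *: v + s *: v',
                 (1 - s) * t + s * t') Q
  = (1 - s) * graph_form (x, v, t) Q + s * graph_form (x', v', t') Q.
  rewrite /graph_form /= !dotvE; ring.
have s1' : 0 <= 1 - s by lra.
have := mulr_ge0_le0 s1' (P Q GQ); have := mulr_ge0_le0 (ltW s0) (P' Q GQ); lra.
Qed.

(** The point sought is a [z] with [dotv (w - x + z) (y - z) >= 0] for all graph
    points [(y, w)] of [B]. With [b := (y - (w - x)) / 2] and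
    [t := - dotv (w - x) y] this reads [t - 2 * dotv z b + dotv z z <= 0]. The
    pairs [(b, t)] coming from the bipolar form a convex set on which
    [bipolar_diag] bounds [t - dotv b b] by 0, so [concave_maximum] applies and
    its optimality condition yields [z]. *)
Lemma minty B x : maximal_monotone B -> exists z, B z (x - z).
Proof.
move=> maxB; have [y0 [w0 By0]] := maximal_monotone_inhabited maxB.
pose G (P : point) :=
  exists y w, B y w /\ P = (y, w - x, - dotv (w - x) y).
have GG Q : G Q -> graph_polar G Q.
  move=> [y [w [Byw ->]]] _ [y' [w' [Byw' ->]]]; rewrite /graph_form /=.
  have := maxB.1 _ _ _ _ Byw Byw'.
  by rewrite !dotvE (dotvC y w') (dotvC y x); lra.
have half (y v : 'rV[R]_n) t : graph_polar (graph_polar G) (y, v, t) ->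
    t - dotv (2^-1 *: (y - v)) (2^-1 *: (y - v)) <= 0.
  move=> /(bipolar_diag GG); have := dotv_ge0 (y + v).
  by rewrite /graph_form /= !dotvE (dotvC v y); lra.
have [|||zs [t [z [t_ [St zz tt h]]]]] := @concave_maximum R n
    (fun b t => exists y v, graph_polar (graph_polar G) (y, v, t)
                            /\ b = 2^-1 *: (y - v)) 0.
- exists (2^-1 *: (y0 - (w0 - x))), (- dotv (w0 - x) y0), y0, (w0 - x).
  by split => //; apply: sub_bipolar; exists y0, w0.
- move=> _ t _ t' s [y [v [P ->]]] [y' [v' [P' ->]]] s0 s1.
  exists ((1 - s) *: y + s *: y'), ((1 - s) *: v + s *: v').
  split; first exact: graph_polar_convex.
  by apply/rowP => i; rewrite !mxE; ring.
- by move=> _ t [y [v [P ->]]]; exact: half.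
have t_le : t_ - dotv z z <= 0.
  apply: (@cvg_le_cst _ (fun m => t m - dotv (zs m) (zs m))).
    by apply: cvgB => //; exact: cvg_dotv.
  by move=> m; have [y [v [P ->]]] := St m; exact: half.
exists z; apply: (maximal_monotone_mem maxB) => y w Byw.
have := h (2^-1 *: (y - (w - x))) (- dotv (w - x) y).
have S : exists y' v', graph_polar (graph_polar G) (y', v', - dotv (w - x) y)
           /\ 2^-1 *: (y - (w - x)) = 2^-1 *: (y' - v').
  by exists y, (w - x); split => //; apply: sub_bipolar; exists y, w.
move=> /(_ S); move: t_le; rewrite !dotvE (dotvC z w) (dotvC z x).
by have := dotvC z y; lra.
Qed.

Lemma resolventP B x : maximal_monotone B ->
  B (resolvent B x) (x - resolvent B x).
Proof.
move=> maxB; have [z Bz] := minty x maxB.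
have [v] : [set z | exists2 v, B z v & z + v = x] (resolvent B x).
  by apply: xgetPex; exists z, (x - z) => //; rewrite addrC subrK.
by move=> Bv E; have -> : x - resolvent B x = v by rewrite -{1}E addrC addKr.
Qed.

End Minty.
(** * Natural residual and stability of the solution set *)

Section Residual.
Context {R : realType} {n : nat}.
Implicit Types (F : 'rV[R]_n -> 'rV[R]_n) (B : sv_operator R n).

(** Both [y] and [resolvent B (y - F y)] come with a value of [B], namely [v] and
    [natres F B y - F y]; monotonicity gives
    [dotv (F y + v - natres F B y) (natres F B y) >= 0]. *)
Lemma natres_le F B y v : maximal_monotone B -> B y v ->
  enorm (natres F B y) <= enorm (F y + v).
Proof.
move=> maxB Byv; rewrite /natres; set r := resolvent B (y - F y).
have Br : B r (y - F y - r) by exact: resolventP.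
have := maxB.1 _ _ _ _ Byv Br.
have -> : v - (y - F y - r) = (F y + v) - (y - r).
  by apply/rowP => i; rewrite !mxE; ring.
move: (F y + v) (y - r) => d q; rewrite dotvDl dotvNl => dq.
have := cauchy_schwarz d q; have := enorm_sqr q => qq cs.
have [q0|q0] := eqVneq (enorm q) 0; first by rewrite q0 enorm_ge0.
have qp : 0 < enorm q by rewrite lt0r q0 enorm_ge0.
by rewrite -(ler_pM2r qp) -expr2 qq; lra.
Qed.

(** The graph of [F + B] is closed at 0: the pair [(a, - F a)] is monotonically
    related to every graph point of [B], up to errors vanishing with [e]. *)
Lemma Sol_of_approx (D : set 'rV[R]_n) F B (L : R) (a : 'rV[R]_n) :
  maximal_monotone B -> closure (sv_dom B) `<=` D -> 0 < L ->
  elipschitz_on L D F ->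
  (forall e, 0 < e -> exists y v,
     [/\ B y v, enorm (y - a) < e & enorm (F y + v) < e]) ->
  Sol D F B a.
Proof.
move=> maxB clD L0 lipF happ.
have cla : closure (sv_dom B) a.
  apply: closure_enormP => e e0; have [y [v [Byv ya _]]] := happ e e0.
  by exists y => //; exists v.
split; first exact: clD.
exists (- F a); last by rewrite subrr.
apply: (maximal_monotone_mem maxB) => y w Byw.
rewrite -oppr_le0; set A := - F a - w; set W := a - y.
apply: (@le0_small _ _ (enorm A + (L + 1) * (enorm W + 1))) => s s0 s1.
have [z [v [Bzv za zv]]] := happ s s0.
have Dz : D z by apply/clD/subset_closure; exists v.
have h := maxB.1 _ _ _ _ Bzv Byw.
have : v - w = A - (F z - F a - (F z + v)).
  by rewrite /A; apply/rowP => i; rewrite !mxE; ring.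
have : z - y = W + (z - a).
  by rewrite /W; apply/rowP => i; rewrite !mxE; ring.
move=> Ez Ev; move: h; rewrite Ez Ev; set q := F z - F a - (F z + v).
have qle : enorm q <= (L + 1) * s.
  rewrite /q; apply: (le_trans (enormD _ _)); rewrite enormN mulrDl mul1r.
  apply: lerD; last exact: ltW.
  by rewrite (le_trans (lipF _ _ Dz (clD _ cla))) // ler_pM2l // ltW.
move=> h.
have c1 := cauchy_schwarz A (z - a).
have c2 := cauchy_schwarz (- q) (W + (z - a)).
have c3 : enorm A * enorm (z - a) <= enorm A * s.
  by rewrite ler_wpM2l ?enorm_ge0 // ltW.
have c4 : enorm (- q) * enorm (W + (z - a)) <= (L + 1) * s * (enorm W + 1).
  rewrite enormN ler_pM ?enorm_ge0 //; apply: (le_trans (enormD _ _)).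
  by rewrite lerD2l ltW // (lt_trans za).
move: h c2; rewrite dotvDl [dotv A _]dotvDr; lra.
Qed.

End Residual.

(** * A summability argument *)

(** If [a k] stayed above [e] from [N] on, [Psi] would decrease by [e] times the
    tail of the divergent harmonic series. *)
Lemma liminf_weighted_harmonic (R : realType) (Psi a : nat -> R) :
  (forall k, 0 <= Psi k) ->
  (forall k, Psi k.+1 <= Psi k - a k / k.+1%:R) ->
  forall e, 0 < e -> forall N, exists2 k, (N <= k)%N & a k < e.
Proof.
move=> Psi0 dec e e0 N; apply: contrapT => nex.
have ae k : (N <= k)%N -> e <= a k.
  by move=> Nk; rewrite leNgt; apply/negP => ?; apply: nex; exists k.
apply: (@dvg_harmonic R); apply: nondecreasing_is_cvgn.
  apply/nondecreasing_seqP => k; rewrite /series /= big_nat_recr //= lerDl.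
  by rewrite invr_ge0.
pose H m : R := series (@harmonic R) m.
have HS m : H m.+1 = H m + m.+1%:R^-1 by rewrite /H /series /= big_nat_recr.
have bound j : e * H (N + j)%N + Psi (N + j)%N <= e * H N + Psi N.
  elim: j => [|j IH]; first by rewrite addn0.
  apply: le_trans IH; rewrite addnS HS.
  have := dec (N + j)%N; have := ae (N + j)%N (leq_addr _ _).
  have : 0 <= (N + j).+1%:R^-1 :> R by rewrite invr_ge0.
  move: (_.+1%:R^-1) => c c0 /(ler_wpM2r c0); lra.
exists ((e * H N + Psi N) / e) => _ [m _ <-].
have Hmono : H m <= H (N + m)%N.
  elim: (N) => [|j IH]; first by rewrite add0n.
  by rewrite addSn HS (le_trans IH) // lerDl invr_ge0.
rewrite ler_pdivlMr // mulrC.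
have := bound m; have := Psi0 (N + m)%N.
have : e * H m <= e * H (N + m)%N by rewrite ler_pM2l.
rewrite -/(H m); lra.
Qed.
(** * The energy estimate *)

Section Energy.
Context {R : realType} {n : nat}.

(** Read [th], [T], [d'], [d], [e] as [th k], [T k], [d k], [d k.+1], [e k.+1]
    and [p] as [y k - u k]; the vector next to [d - d'] is then [y k.+1 - y k],
    and the one next to [d] in the conclusion is [y k.+1 - u k]. After expansion
    the conclusion is a linear combination of the three hypotheses, with weights
    [T / 2] for the squared error bound, [(1 - th)^-1] for monotonicity and [th]
    for the energy. *)
Lemma energy_step (T th : R) (d d' e p : 'rV[R]_n) : 0 < T -> 0 <= th -> th < 1 ->
  enorm e <= enorm (d + e - th *: d') ->
  0 <= th * dotv (d - d') (- ((1 - th) *: (p + T *: (d + e)))) ->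
  th * T / 2 * dotv d' d' + dotv d' p <= 0 ->
  T / 2 * dotv d d + dotv d (th *: p - ((1 - th) * T) *: (d + e)) <= 0.
Proof.
move=> T0 th0 th1; rewrite le_enorm => He mon Hd'.
have {}mon : 0 <= - th * (dotv d p - dotv d' p) - th * T *
    (dotv d d + dotv d e - dotv d d' - dotv d' e).
  rewrite -(@pmulr_rge0 _ (1 - th)) ?subr_gt0 //; move: mon.
  by rewrite !dotvE (dotvC d' d); lra.
have {}Hd' := mulr_ge0_le0 th0 Hd'.
have {}He : 0 <= T * (dotv d d + th ^+ 2 * dotv d' d' + 2 * dotv d e
    - 2 * th * dotv d d' - 2 * th * dotv d' e).
  rewrite mulr_ge0 ?(ltW T0) //; move: He.
  by rewrite !dotvE (dotvC e d) (dotvC e d') (dotvC d' d); lra.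
by rewrite !dotvE; lra.
Qed.

(** Convexity of the square, for [th *: p + (1 - th) *: (g / (1 - th))]. *)
Lemma enorm_sqr_relax (th : R) (p g : 'rV[R]_n) : 0 <= th -> th < 1 ->
  dotv (th *: p + g) (th *: p + g) <= th * dotv p p + (1 - th)^-1 * dotv g g.
Proof.
move=> th0 th1; have h1 : 0 < 1 - th by rewrite subr_gt0.
rewrite -(ler_pM2l h1) mulrDr [_ * (_^-1 * _)]mulrA divff ?gt_eqF // mul1r.
have := mulr_ge0 th0 (dotv_ge0 ((1 - th) *: p - g)).
by rewrite !dotvE (dotvC g p); lra.
Qed.

End Energy.

(** * The iteration *)

Section Iteration.
Context {R : realType} {n : nat}.
Context (domF : set 'rV[R]_n) (F : 'rV[R]_n -> 'rV[R]_n) (B : sv_operator R n).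
Context (X : set 'rV[R]_n) (sigma rho L : R) (x0 : 'rV[R]_n).
Context (lam : nat -> R) (x y d u : nat -> 'rV[R]_n).
Context (F_mono : monotone_on domF F).
Context (B_max : maximal_monotone B).
Context (domB_domF : closure (sv_dom B) `<=` domF).
Context (X_neq0 : X !=set0) (X_closed : closed X) (X_convex : convex_set X).
Context (domB_X : closure (sv_dom B) `<=` X).
Context (sigma_gt0 : 0 < sigma) (sigma_lt1 : sigma < 1) (L_gt0 : 0 < L).
Context (rho_gt0 : 0 < rho) (rho_lt_half : rho < 1 / 2).
Context (lamE : forall k, (1 <= k)%N -> lam k = sigma / L).
Context (run : MAEG_run F B X sigma rho x0 lam x y d u).

(** Here [th k] is 1 - tau_(k+1), [c k] the relaxed point
   tau_(k+1) u_k + (1 - tau_(k+1)) y_k, [T k] is la / tau_(k+1), and [e k] the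
   error made by evaluating F at x_k instead of y_k. *)
Let la : R := sigma / L.
Let eta : R := 1 - 2 * rho.
Let T (k : nat) : R := (eta * k%:R + 1) * la.
Let th (k : nat) : R := eta * k%:R / (eta * k%:R + 1).
Let c (k : nat) : 'rV[R]_n := u k + th k *: (y k - u k).
Let e (k : nat) : 'rV[R]_n := F (x k) - F (y k).

Let la_gt0 : 0 < la. Proof. exact: divr_gt0. Qed.
Let eta_gt0 : 0 < eta.
Proof. by rewrite /eta subr_gt0 mulrC -ltr_pdivlMr. Qed.
Let eta_lt1 : eta < 1. Proof. by rewrite /eta ltrBlDr ltrDl mulr_gt0. Qed.
Let etak_ge0 k : 0 <= eta * k%:R. Proof. by rewrite mulr_ge0 ?ler0n // ltW. Qed.
Let den_gt0 k : 0 < eta * k%:R + 1. Proof. exact: ltr_wpDl (etak_ge0 k) ltr01. Qed.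
Let th_ge0 k : 0 <= th k. Proof. by rewrite divr_ge0 // ltW. Qed.
Let th_lt1 k : th k < 1. Proof. by rewrite ltr_pdivrMr // mul1r ltrDl ltr01. Qed.
Let T_gt0 k : 0 < T k. Proof. by rewrite mulr_gt0. Qed.
Let thT k : th k * T k = eta * k%:R * la.
Proof. by rewrite /th /T mulrA divfK // gt_eqF. Qed.

Lemma LamE k : Lam lam k = k%:R * la.
Proof.
elim: k => [|k IH]; first by rewrite /Lam big_geq // mul0r.
by rewrite /Lam big_nat_recr //= -/(Lam lam k) IH lamE // -natr1 mulrDl mul1r.
Qed.

Lemma tauE k : tau rho lam k.+1 = 1 - th k.
Proof.
rewrite /tau /= LamE lamE // -/la -/eta /th.
have h := den_gt0 k; have ? : eta * k%:R + 1 != 0 by rewrite gt_eqF.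
have ? : la != 0 by rewrite gt_eqF.
have -> : eta * (k%:R * la) + la = (eta * k%:R + 1) * la by ring.
by field; apply/andP.
Qed.

Lemma averageE k :
  tau rho lam k.+1 *: u k + (1 - tau rho lam k.+1) *: y k = c k.
Proof. by rewrite tauE /c; apply/rowP => i; rewrite !mxE; ring. Qed.

Lemma x_succ k : x k.+1 = Defs.proj X (c k - (la * th k) *: d k).
Proof.
rewrite (MAEG_x run) // lamE // -/la -averageE /=; congr (Defs.proj _ _).
by rewrite tauE; apply/rowP => i; rewrite !mxE; ring.
Qed.

Lemma y_succ k :
  y k.+1 = resolvent (sv_scale la B) (c k - la *: F (x k.+1)).
Proof. by rewrite (MAEG_y run) // lamE // -averageE. Qed.

Lemma d_succ k : la *: d k.+1 = c k - y k.+1 - la *: e k.+1.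
Proof.
rewrite (MAEG_d run) // averageE lamE // -/la /e.
have la0 : la != 0 by rewrite gt_eqF.
by apply/rowP => i; rewrite !mxE; field.
Qed.

Lemma u_succ k : u k.+1 = u k - (rho * la) *: d k.+1.
Proof. by rewrite (MAEG_u run) // lamE. Qed.

Lemma residual_mem k : (1 <= k)%N -> B (y k) (d k - F (y k)).
Proof.
case: k => // k _.
have := resolventP (c k - la *: F (x k.+1)) (maximal_monotone_scale la_gt0 B_max).
rewrite -y_succ => -[v Bv Ev].
have -> // : d k.+1 - F (y k.+1) = v.
apply: (@scalerI _ _ la); first by rewrite gt_eqF.
rewrite Ev scalerBr d_succ /e.
by apply/rowP => i; rewrite !mxE; ring.
Qed.

Lemma residual_mono k z w : (1 <= k)%N -> B z w ->
  0 <= dotv (d k - (F z + w)) (y k - z).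
Proof.
move=> k1 Bzw; have Bk := residual_mem k1.
have -> : d k - (F z + w) = (F (y k) - F z) + (d k - F (y k) - w).
  by apply/rowP => i; rewrite !mxE; ring.
rewrite dotvDl addr_ge0 //; last exact: B_max.1 Bk Bzw.
by apply: F_mono; apply/domB_domF/subset_closure;
  [exists (d k - F (y k))|exists w].
Qed.

(** The stepsize rule bounds the error by [sigma * enorm (x k.+1 - y k.+1)]; as
    [y k.+1] lies in [X], the point projected to [x k.+1] is at least as far
    from [y k.+1] as [x k.+1] is. *)
Lemma error_le k : enorm (e k.+1) <= sigma * enorm (d k.+1 + e k.+1 - th k *: d k).
Proof.
have yX : X (y k.+1).
  by apply/domB_X/subset_closure; exists (d k.+1 - F (y k.+1)); exact: residual_mem.
have := MAEG_stepsize run (ltn0Sn k); rewrite lamE // -/la -/(e k.+1) => step.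
rewrite -(ler_pM2l la_gt0); apply: (le_trans step).
rewrite mulrCA ler_pM2l // x_succ.
apply: (le_trans (enorm_proj_le _ X_neq0 X_closed X_convex yX)).
have -> : c k - (la * th k) *: d k - y k.+1
    = la *: (d k.+1 + e k.+1 - th k *: d k).
  have -> : la *: (d k.+1 + e k.+1 - th k *: d k)
      = la *: d k.+1 + la *: e k.+1 - (la * th k) *: d k.
    by apply/rowP => i; rewrite !mxE; ring.
  rewrite d_succ.
  by apply/rowP => i; rewrite !mxE; ring.
by rewrite enormZ ger0_norm // ltW.
Qed.

Lemma gap_succ k :
  y k.+1 - u k = th k *: (y k - u k) - ((1 - th k) * T k) *: (d k.+1 + e k.+1).
Proof.
have -> : (1 - th k) * T k = la by rewrite mulrBl thT mul1r /T; ring.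
have -> : la *: (d k.+1 + e k.+1) = la *: d k.+1 + la *: e k.+1.
  by rewrite scalerDr.
by rewrite d_succ /c; apply/rowP => i; rewrite !mxE; ring.
Qed.

Lemma energy_le0 k :
  eta * k%:R * la / 2 * dotv (d k) (d k) + dotv (d k) (y k - u k) <= 0.
Proof.
elim: k => [|k IH]; first by rewrite (MAEG_d0 run) !dotv0l mulr0 addr0.
have mon : 0 <= th k * dotv (d k.+1 - d k)
    (- ((1 - th k) *: ((y k - u k) + T k *: (d k.+1 + e k.+1)))).
  (* [d 0 = 0] is not a residual at [y 0], but then the weight [th 0] is 0. *)
  case: k {IH} => [|k]; first by rewrite /th mulr0 !mul0r.
  rewrite mulr_ge0 //.
  have := residual_mono (ltn0Sn k.+1) (residual_mem (ltn0Sn k)).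
  have -> : F (y k.+1) + (d k.+1 - F (y k.+1)) = d k.+1 by rewrite addrC subrK.
  congr (0 <= dotv _ _).
  have -> : y k.+2 - y k.+1 = (y k.+2 - u k.+1) - (y k.+1 - u k.+1).
    by apply/rowP => i; rewrite !mxE; ring.
  rewrite gap_succ; move: (y k.+1 - u k.+1) => p.
  by apply/rowP => i; rewrite !mxE; ring.
rewrite -thT in IH.
have err : enorm (e k.+1) <= enorm (d k.+1 + e k.+1 - th k *: d k).
  by apply: (le_trans (error_le k)); rewrite ler_piMl ?enorm_ge0 // ltW.
have := energy_step (T_gt0 k) (th_ge0 k) (th_lt1 k) err mon IH.
rewrite -gap_succ; congr (_ <= 0).
have -> : y k.+1 - u k.+1 = (y k.+1 - u k) + (rho * la) *: d k.+1.
  by rewrite u_succ; apply/rowP => i; rewrite !mxE; ring.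
by rewrite [in RHS]dotvDr dotvZr /T /eta -natr1; field.
Qed.

(** Energy estimate plus [dotv (d k) (y k - z) >= 0]. *)
Lemma residual_dot_le k z : Sol domF F B z ->
  eta * k%:R * la / 2 * dotv (d k) (d k) <= dotv (d k) (u k - z).
Proof.
move=> [_ [v Bv Fv]].
case: k => [|k]; first by rewrite (MAEG_d0 run) !dotv0l mulr0.
have := residual_mono (ltn0Sn k) Bv; rewrite Fv subr0 => mon.
have := energy_le0 k.+1.
have -> : u k.+1 - z = (y k.+1 - z) - (y k.+1 - u k.+1).
  by apply/rowP => i; rewrite !mxE; ring.
by rewrite [dotv _ (_ - z - _)]dotvDr dotvNr; lra.
Qed.

Lemma residual_rate k z : (1 <= k)%N -> Sol domF F B z ->
  enorm (d k) <= 2 * L * enorm (u k - z) / (eta * sigma * k%:R).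
Proof.
move=> k1 Sz; have k0 : 0 < k%:R :> R by rewrite ltr0n.
have ek0 : 0 < eta * sigma * k%:R by rewrite !mulr_gt0.
have h := le_trans (residual_dot_le k Sz) (cauchy_schwarz _ _).
have [->|d0] := eqVneq (enorm (d k)) 0.
  by rewrite divr_ge0 ?(ltW ek0) // mulr_ge0 ?enorm_ge0 // mulr_ge0 // ltW.
have {}d0 : 0 < enorm (d k) by rewrite lt0r d0 enorm_ge0.
rewrite ler_pdivlMr //.
move: h; rewrite -enorm_sqr expr2 mulrCA ler_pM2l // /la => h.
rewrite -(ler_pM2r (_ : 0 < 2^-1 / L)); last by rewrite divr_gt0 // invr_gt0.
have L0 : L != 0 by rewrite gt_eqF.
have -> : 2 * L * enorm (u k - z) * (2^-1 / L) = enorm (u k - z) by field.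
by apply: le_trans h; rewrite le_eqVlt; apply/orP; left; apply/eqP; field.
Qed.

Let gamma : R := rho * eta * la ^+ 2.
Let gamma_gt0 : 0 < gamma.
Proof. by rewrite /gamma mulr_gt0 ?exprn_gt0 // mulr_gt0. Qed.

(** Writing [u k = u k.+1 + (rho * la) *: d k.+1] puts the cross term at
    [u k.+1], where [residual_dot_le] bounds it from below. *)
Lemma fejer k z : Sol domF F B z ->
  dotv (u k.+1 - z) (u k.+1 - z) + gamma * (k.+1%:R * dotv (d k.+1) (d k.+1))
  <= dotv (u k - z) (u k - z).
Proof.
move=> Sz.
have -> : u k - z = (u k.+1 - z) + (rho * la) *: d k.+1.
  by rewrite u_succ; apply/rowP => i; rewrite !mxE; ring.
have r0 : 0 <= 2 * (rho * la) by rewrite mulr_ge0 // mulr_ge0 // ltW.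
have := ler_wpM2l r0 (residual_dot_le k.+1 Sz).
have : 0 <= (rho * la) * (rho * la) * dotv (d k.+1) (d k.+1).
  by rewrite mulr_ge0 ?dotv_ge0 // -expr2 sqr_ge0.
rewrite /gamma; move: (k.+1%:R : R) => m.
by move: (u k.+1 - z) (d k.+1) => a b; rewrite !dotvE (dotvC b a); lra.
Qed.

Lemma fejer_mono z : Sol domF F B z -> forall k m, (k <= m)%N ->
  enorm (u m - z) <= enorm (u k - z).
Proof.
move=> Sz k; elim=> [|m IH]; first by rewrite leqn0 => /eqP->.
rewrite leq_eqVlt => /predU1P[-> //|km]; apply: le_trans (IH km).
rewrite le_enorm; apply: le_trans (fejer m Sz); rewrite lerDl.
by rewrite mulr_ge0 ?(ltW gamma_gt0) // mulr_ge0 ?dotv_ge0.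
Qed.
(** * Convergence and rate *)

Let K : R := la / (1 - sigma).

(** The bound of [error_le] involves the error itself with the factor
    [sigma < 1]; absorbing it produces [1 - sigma] in [K]. *)
Lemma increment_le k :
  enorm (la *: ((1 - rho) *: d k.+1 + e k.+1))
  <= K * (enorm (d k.+1) + enorm (d k)).
Proof.
have s0 : 0 < 1 - sigma by rewrite subr_gt0.
have ele : (1 - sigma) * (enorm (d k.+1) + enorm (e k.+1))
    <= enorm (d k.+1) + enorm (d k).
  have h1 : enorm (th k *: d k) <= enorm (d k).
    by rewrite enormZ ger0_norm // ler_piMl ?enorm_ge0 // ltW.
  have h2 := enormD (d k.+1 + e k.+1) (- (th k *: d k)).
  have h3 := enormD (d k.+1) (e k.+1); rewrite enormN in h2.
  have h4 : sigma * enorm (d k.+1 + e k.+1 - th k *: d k)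
      <= sigma * (enorm (d k.+1) + enorm (e k.+1) + enorm (d k)).
    by rewrite ler_pM2l //; lra.
  have h5 : sigma * enorm (d k) <= enorm (d k).
    by rewrite ler_piMl ?enorm_ge0 // ltW.
  have := error_le k; lra.
have dle : enorm ((1 - rho) *: d k.+1 + e k.+1) <= enorm (d k.+1) + enorm (e k.+1).
  apply: (le_trans (enormD _ _)); rewrite lerD2r enormZ ger0_norm.
    by rewrite ler_piMl ?enorm_ge0 // gerBl ltW.
  by rewrite subr_ge0 ltW // (lt_trans rho_lt_half) // ltr_pdivrMr // mul1r ltr1n.
rewrite enormZ ger0_norm ?(ltW la_gt0) // /K -mulrA ler_pM2l //.
rewrite -(ler_pM2l s0) mulrA divff ?gt_eqF // mul1r.
by apply: le_trans ele; rewrite ler_pM2l.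
Qed.

Let D (k : nat) : R := dotv (d k) (d k).
Let a (k : nat) : R := dotv (y k - u k) (y k - u k).

(** One step contracts the gap by [th k <= 1 - k.+1%:R^-1] and adds the increment
    of [increment_le], weighted by [(1 - th k)^-1 <= k.+1%:R]. *)
Lemma gap_sqr k :
  a k.+1 <= a k - a k / k.+1%:R
            + 2 * K ^+ 2 * (k.+1%:R * D k.+1 + 2 * (k%:R * D k)).
Proof.
have gE : y k.+1 - u k.+1
    = th k *: (y k - u k) + - (la *: ((1 - rho) *: d k.+1 + e k.+1)).
  have -> : y k.+1 - u k.+1 = (y k.+1 - u k) + (rho * la) *: d k.+1.
    by rewrite u_succ; apply/rowP => i; rewrite !mxE; ring.
  rewrite gap_succ.
  have -> : (1 - th k) * T k = la by rewrite mulrBl thT mul1r /T; ring.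
  by apply/rowP => i; rewrite !mxE; ring.
have thE : 1 - th k = (eta * k%:R + 1)^-1.
  by rewrite /th; field; rewrite gt_eqF // den_gt0.
have denle : eta * k%:R + 1 <= k.+1%:R.
  by rewrite -natr1 lerD2r ler_piMl ?ler0n // ltW.
have thle : a k / k.+1%:R <= (1 - th k) * a k.
  rewrite mulrC ler_wpM2r ?dotv_ge0 // thE lef_pV2 ?posrE ?ltr0n //.
have dle : k.+1%:R * D k <= 2 * (k%:R * D k).
  case: (posnP k) => [->|k0].
    by rewrite /D (MAEG_d0 run) dotv0l !mulr0.
  rewrite mulrA ler_wpM2r ?dotv_ge0 // -natrM ler_nat mul2n -addnn -addn1.
  by rewrite leq_add2l.
rewrite /a gE; apply: (le_trans (enorm_sqr_relax _ _ (th_ge0 k) (th_lt1 k))).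
set g := - (la *: _); rewrite -/(a k) thE invrK.
have gle : dotv g g <= 2 * K ^+ 2 * (D k.+1 + D k).
  rewrite -enorm_sqr /g enormN.
  have h := increment_le k.
  have K0 : 0 <= K * (enorm (d k.+1) + enorm (d k)) by exact: le_trans (enorm_ge0 _) h.
  have : enorm (la *: ((1 - rho) *: d k.+1 + e k.+1)) ^+ 2
      <= (K * (enorm (d k.+1) + enorm (d k))) ^+ 2.
    by rewrite ler_pXn2r // nnegrE enorm_ge0.
  move=> h2; apply: (le_trans h2); rewrite exprMn /D -!enorm_sqr.
  by have := mulr_ge0 (sqr_ge0 K) (sqr_ge0 (enorm (d k.+1) - enorm (d k))); lra.
have {}gle : (eta * k%:R + 1) * dotv g g <= k.+1%:R * (2 * K ^+ 2 * (D k.+1 + D k)).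
  by apply: ler_pM; rewrite ?dotv_ge0 // ltW.
have K2 : 0 <= 2 * K ^+ 2 by rewrite mulr_ge0 // sqr_ge0.
have := ler_wpM2l K2 dle.
move: gle thle; rewrite mulrBl mul1r; move: (k.+1%:R : R) => m; lra.
Qed.

(** The Fejer decrease absorbs the terms [k * |d k|^2] of [gap_sqr]: the constant
    3 pays for the term at [k.+1] there and for the term that [Psi k.+1] keeps
    to pay for the one at [k] in the next step. *)
Lemma gap_small z : Sol domF F B z ->
  forall s, 0 < s -> forall N, exists2 k, (N <= k)%N & enorm (y k - u k) < s.
Proof.
move=> Sz s s0 N; pose C : R := 2 * K ^+ 2.
have C0 : 0 <= C by rewrite mulr_ge0 // sqr_ge0.
pose Phi k := dotv (u k - z) (u k - z).
pose Psi k := a k + 3 * C / gamma * Phi k + 2 * C * (k%:R * D k).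
have [|||k Nk ak] := @liminf_weighted_harmonic R Psi a _ _ (s ^+ 2) _ N.
- move=> k; rewrite /Psi !addr_ge0 ?dotv_ge0 //.
    by rewrite mulr_ge0 ?dotv_ge0 // divr_ge0 ?(ltW gamma_gt0) // mulr_ge0.
  by apply: mulr_ge0; apply: mulr_ge0; rewrite ?dotv_ge0 ?ler0n.
- move=> k; have C3 : 0 <= 3 * C / gamma.
    by rewrite divr_ge0 ?(ltW gamma_gt0) // mulr_ge0.
  have := ler_wpM2l C3 (fejer k Sz); rewrite -/(Phi k) -/(Phi k.+1) -/(D k.+1).
  rewrite [_ * (_ + gamma * _)]mulrDr [_ * (gamma * _)]mulrA divfK ?gt_eqF //.
  have := gap_sqr k; rewrite /Psi -/C; move: (3 * C / gamma) => c3.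
  move: (a k / _) => q; move: (k.+1%:R * _) => r; lra.
- exact: exprn_gt0.
exists k => //; rewrite -(ltr_pXn2r (_ : 0 < 2)%N) ?nnegrE ?enorm_ge0 ?(ltW s0) //.
by rewrite enorm_sqr.
Qed.

Lemma residual_small z : Sol domF F B z -> forall s, 0 < s ->
  exists N, forall k, (N <= k)%N -> enorm (d k) < s.
Proof.
move=> Sz s s0; pose M := 2 * L * enorm (u 0%N - z) / (eta * sigma).
have M0 : 0 <= M.
  rewrite divr_ge0 ?(ltW (mulr_gt0 eta_gt0 sigma_gt0)) //.
  by rewrite mulr_ge0 ?enorm_ge0 // mulr_ge0 // ltW.
have M1 : 0 < M + 1 by rewrite ltr_wpDl.
have [|N hN] := @harmonic_small R (s / (M + 1)); first exact: divr_gt0.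
exists N.+1 => -[//|k] Nk; have {hN} := hN k Nk.
rewrite ltr_pdivlMr // => hk; apply: le_lt_trans hk.
apply: (le_trans (residual_rate (ltn0Sn k) Sz)).
rewrite invfM mulrA [leRHS]mulrC ler_wpM2r ?invr_ge0 // /M.
apply: (@le_trans _ _ (2 * L * enorm (u 0%N - z) / (eta * sigma))); last first.
  by rewrite lerDl.
rewrite ler_wpM2r ?invr_ge0 ?(ltW (mulr_gt0 eta_gt0 sigma_gt0)) //.
by rewrite ler_wpM2l ?mulr_ge0 ?(ltW L_gt0) //; exact: (fejer_mono Sz).
Qed.

(** Bolzano-Weierstrass along the indices where the gap is below
    [j.+1%:R^-1]. *)
Lemma cluster_exists z : Sol domF F B z -> exists xbar, forall s, 0 < s ->
  forall N, exists2 k, (N <= k)%N &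
    enorm (u k - xbar) < s /\ enorm (y k - u k) < s.
Proof.
move=> Sz.
have /choice[f fP] : forall j : nat, exists k, (j <= k)%N /\
    enorm (y k - u k) < j.+1%:R^-1.
  move=> j; have [|k jk hk] := @gap_small z Sz j.+1%:R^-1 _ j.
    by rewrite invr_gt0 ltr0n.
  by exists k.
have [j|xbar hx] := @bounded_cluster R n (u \o f) (enorm (u 0%N - z) + enorm z).
  have -> : (u \o f) j = (u (f j) - z) + z by rewrite /= subrK.
  by apply: (le_trans (enormD _ _)); rewrite lerD2r; exact: (fejer_mono Sz).
exists xbar => s s0 N; have [N' hN'] := harmonic_small s0.
have [j jN uj] := hx s s0 (maxn N N').
have [fj pj] := fP j; move: jN; rewrite geq_max => /andP[Nj N'j].
exists (f j); first exact: leq_trans fj.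
by split=> //; exact: lt_trans (hN' j N'j).
Qed.

Lemma cluster_Sol z xbar : elipschitz_on L domF F -> Sol domF F B z ->
  (forall s, 0 < s -> forall N, exists2 k, (N <= k)%N &
    enorm (u k - xbar) < s /\ enorm (y k - u k) < s) ->
  Sol domF F B xbar.
Proof.
move=> F_lip Sz hx; apply: (Sol_of_approx B_max domB_domF L_gt0 F_lip) => s s0.
have [N hN] := residual_small Sz s0.
have s2 : 0 < s / 2 by rewrite divr_gt0.
have [k Nk [uk pk]] := hx _ s2 N.+1.
exists (y k), (d k - F (y k)); split.
- exact: residual_mem (leq_trans (ltn0Sn N) Nk).
- have -> : y k - xbar = (y k - u k) + (u k - xbar) by rewrite addrA subrK.
  by apply: (le_lt_trans (enormD _ _)); rewrite [s]splitr ltrD.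
- by rewrite addrC subrK hN // ltnW.
Qed.

Lemma MAEG_convergence (F_lip : elipschitz_on L domF F) (Sol_neq0 : Sol domF F B !=set0) :
  exists2 xbar : 'rV[R]_n, Sol domF F B xbar &
    [/\ u @ \oo --> xbar,
        (fun k => enorm (u k - xbar)) @ \oo --> (0 : R),
        (forall k, (1 <= k)%N ->
           enorm (natres F B (y k)) <= enorm (d k) /\
           enorm (d k) <= 2 * L * enorm (u k - xbar)
                            / ((1 - 2 * rho) * sigma * k%:R)),
        (fun k => enorm (d k) : R^o) =o_\oo (fun k => k%:R^-1 : R^o) &
        (fun k => enorm (natres F B (y k)) : R^o)
          =o_\oo (fun k => k%:R^-1 : R^o)].
Proof.
have [z Sz] := Sol_neq0.
have [xbar hx] := cluster_exists Sz.
have Sx : Sol domF F B xbar by exact: (cluster_Sol F_lip Sz hx).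
have ulim : (fun k => enorm (u k - xbar)) @ \oo --> (0 : R).
  apply/cvgrPdist_lt => s s0; have [N _ [uN _]] := hx s s0 0%N.
  exists N => // k /= Nk; rewrite sub0r normrN ger0_norm ?enorm_ge0 //.
  by apply: le_lt_trans uN; exact: (fejer_mono Sx).
have natres_d k : (1 <= k)%N -> enorm (natres F B (y k)) <= enorm (d k).
  move=> k1; have := natres_le F B_max (residual_mem k1).
  by rewrite addrC subrK.
have d_rate k : (1 <= k)%N -> enorm (d k) <=
    2 * L * enorm (u k - xbar) / ((1 - 2 * rho) * sigma * k%:R).
  move=> k1; exact: (residual_rate k1 Sx).
pose C : R := 2 * L / ((1 - 2 * rho) * sigma).
have C0 : 0 < C by rewrite divr_gt0 ?mulr_gt0 // subr_gt0 mulrC -ltr_pdivlMr.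
have small (w : nat -> R) : (forall k, 0 <= w k) ->
    (forall k, (1 <= k)%N -> w k <= enorm (d k)) ->
    (w : nat -> R^o) =o_\oo (fun k => k%:R^-1 : R^o).
  move=> w0 wd; apply/eqoP => s s0; near=> k.
  have k1 : (1 <= k)%N by near: k; exists 1%N.
  have uk : enorm (u k - xbar) < s / C.
    by near: k; apply: (cvgr_lt _ ulim); exact: divr_gt0.
  rewrite ger0_norm // [`|_|]ger0_norm ?invr_ge0 ?ler0n //.
  apply: (le_trans (wd _ k1)); apply: (le_trans (d_rate _ k1)).
  rewrite invfM mulrA ler_wpM2r ?invr_ge0 ?ler0n // mulrAC -/C.
  by rewrite -ler_pdivlMl // mulrC ltW.
exists xbar => //; split => //; first exact: enorm_cvg.
- by move=> k k1; split; [exact: natres_d|exact: d_rate].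
- by apply: small => // k; exact: enorm_ge0.
- by apply: small => [k|]; [exact: enorm_ge0|exact: natres_d].
Unshelve. all: by end_near. Qed.

End Iteration.

Theorem mainTheorem5 (R : realType) (n : nat)
    (domF : set 'rV[R]_n) (F : 'rV[R]_n -> 'rV[R]_n) (B : sv_operator R n)
    (X : set 'rV[R]_n) (sigma rho L : R) (x0 : 'rV[R]_n)
    (lam : nat -> R) (x y d u : nat -> 'rV[R]_n)
    (F_mono : monotone_on domF F)
    (F_cont : {within domF, continuous F})
    (B_max : maximal_monotone B)
    (domB_domF : closure (sv_dom B) `<=` domF)
    (X_neq0 : X !=set0) (X_closed : closed X) (X_convex : convex_set X)
    (domB_X : closure (sv_dom B) `<=` X) (X_domF : X `<=` domF)
    (x0_dom : closure (sv_dom B) x0)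
    (sigma_gt0 : 0 < sigma) (sigma_lt1 : sigma < 1)
    (Sol_neq0 : Sol domF F B !=set0)
    (L_gt0 : 0 < L) (F_lip : elipschitz_on L domF F)
    (rho_gt0 : 0 < rho) (rho_lt_half : rho < 1 / 2)
    (lamE : forall k, (1 <= k)%N -> lam k = sigma / L)
    (run : MAEG_run F B X sigma rho x0 lam x y d u) :
  exists2 xbar : 'rV[R]_n, Sol domF F B xbar &
    [/\ u @ \oo --> xbar,
        (fun k => enorm (u k - xbar)) @ \oo --> (0 : R),
        (forall k, (1 <= k)%N ->
           enorm (natres F B (y k)) <= enorm (d k) /\
           enorm (d k) <= 2 * L * enorm (u k - xbar)
                            / ((1 - 2 * rho) * sigma * k%:R)),
        (fun k => enorm (d k) : R^o) =o_\oo (fun k => k%:R^-1 : R^o) &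
        (fun k => enorm (natres F B (y k)) : R^o)
          =o_\oo (fun k => k%:R^-1 : R^o)].
Proof.
exact: (MAEG_convergence F_mono B_max domB_domF X_neq0 X_closed X_convex domB_X
  sigma_gt0 sigma_lt1 L_gt0 rho_gt0 rho_lt_half lamE run F_lip Sol_neq0).
Qed.
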